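(* For every $n\ge 1$ and all $\sigma\in\mathfrak{S}_n$, the involution $\widehat{\phi}=\Phi_{\mathrm{SZ}}^{-1}\circ\widehat{\theta}\circ\Phi_{\mathrm{SZ}}$ on $\mathfrak{S}_n$ satisfies $$\big(\underline{31}2(\sigma),\,2\underline{13}(\sigma),\,2\underline{31}(\sigma)\big)=\big(\underline{31}2(\widehat{\phi}(\sigma)),\,2\underline{31}(\widehat{\phi}(\sigma)),\,2\underline{13}(\widehat{\phi}(\sigma))\big).$$ Consequently, $P_n(1,q,r,s)=P_n(1,q,s,r)$, where $$P_n(p,q,r,s)=\sum_{\sigma\in\mathfrak{S}_n}p^{\underline{13}2(\sigma)}q^{\underline{31}2(\sigma)}r^{2\underline{13}(\sigma)}s^{2\underline{31}(\sigma)}.$$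
   Context: $\mathfrak{S}_n$ is the set of permutations $\sigma=\sigma_1\cdots\sigma_n$ of $[n]=\{1,\dots,n\}$; $\sigma^{-1}_\ell$ denotes the position of the letter $\ell$ in $\sigma$. Vincular pattern statistics: for $1\le \ell\le n$ let - $2\underline{13}(\ell,\sigma)=\#\{j:\sigma^{-1}_\ell<j<n,\ \sigma_j<\ell<\sigma_{j+1}\}$, - $2\underline{31}(\ell,\sigma)=\#\{j:\sigma^{-1}_\ell<j<n,\ \sigma_{j+1}<\ell<\sigma_j\}$, - $\underline{31}2(\ell,\sigma)=\#\{j:1<j<\sigma^{-1}_\ell,\ \sigma_j<\ell<\sigma_{j-1}\}$, - $\underline{13}2(\ell,\sigma)=\#\{j:1<j<\sigma^{-1}_\ell,\ \sigma_{j-1}<\ell<\sigma_j\}$, and let $2\underline{13}(\sigma)$, $2\underline{31}(\sigma)$, $\underline{31}2(\sigma)$, $\underline{13}2(\sigma)$ be the sums of the corresponding quantities over $1\le\ell\le n$. The bijection $\Phi_{\mathrm{SZ}}:\mathfrak{S}_n\to\mathfrak{S}_n$: given $\sigma$, let $F$ be the set of descent tops (letters $\sigma_i$ with $1\le i<n$, $\sigma_i>\sigma_{i+1}$) and $F'$ the set of descent bottoms (letters $\sigma_{i+1}$ with $1\le i<n$, $\sigma_i>\sigma_{i+1}$); let $G=[n]\setminus F$, $G'=[n]\setminus F'$. Define $\tau=\Phi_{\mathrm{SZ}}(\sigma)$ as follows. Going through $j\in F$ from the smallest to the largest, let $\tau_j$ be the $(\underline{31}2(j,\sigma)+1)$-th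 largest entry of $F'$ that is smaller than $j$ and not yet chosen. Going through $j\in G$ from the largest to the smallest, let $\tau_j$ be the $(\underline{31}2(j,\sigma)+1)$-th smallest entry of $G'$ that is not smaller than $j$ and not yet chosen. (This is known to be a well-defined bijection.) The map $\widehat{\theta}:\mathfrak{S}_n\to\mathfrak{S}_n$ is $\widehat{\theta}(\sigma)=\widehat{\sigma}_n\widehat{\sigma}_{n-1}\cdots\widehat{\sigma}_1$, where $\widehat{a}=n-a$ if $1\le a<n$ and $\widehat{n}=n$. *)

(* Defs.v *)
From mathcomp Require Import all_boot all_fingroup all_algebra.
Set Implicit Arguments.
Unset Strict Implicit.
Unset Printing Implicit Defensive.

(* Permutations of [n] are elements s of 'S_n; s i is the letter in position  *)
(* i, and (s^-1)%g l is the position of the letter l.  Positions and letters  *)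
(* are both numbered from 0, so the letter a of [n] is the ordinal a - 1; the *)
(* pattern statistics only compare letters with letters and positions with    *)
(* positions, so they are not affected by the shift.                          *)

(* The pairs of adjacent positions (j, j + 1). *)
Definition consecutive n : {set 'I_n * 'I_n} :=
  [set p : 'I_n * 'I_n | (p.2 : nat) == p.1.+1].

Section Statistics.
Variables (n : nat) (s : 'S_n).
Implicit Type l : 'I_n.

(* In the names of the statistics, the two digits that are not separated by   *)
(* an underscore are the underlined (adjacent) ones.                          *)
Definition vinc2_13_at l := #|[set p in consecutive n |
  [&& (s^-1)%g l < p.1, s p.1 < l & l < s p.2]]|.
Definition vinc2_31_at l := #|[set p in consecutive n |
  [&& (s^-1)%g l < p.1, s p.2 < l & l < s p.1]]|.
Definition vinc31_2_at l := #|[set p in consecutive n |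
  [&& p.2 < (s^-1)%g l, s p.2 < l & l < s p.1]]|.
Definition vinc13_2_at l := #|[set p in consecutive n |
  [&& p.2 < (s^-1)%g l, s p.1 < l & l < s p.2]]|.

Definition vinc2_13 : nat := \sum_l vinc2_13_at l.
Definition vinc2_31 : nat := \sum_l vinc2_31_at l.
Definition vinc31_2 : nat := \sum_l vinc31_2_at l.
Definition vinc13_2 : nat := \sum_l vinc13_2_at l.

Definition descents := [set p in consecutive n | s p.2 < s p.1].
Definition descent_tops := [set s p.1 | p in descents].
Definition descent_bottoms := [set s p.2 | p in descents].

End Statistics.

(* The elements j of the list js are processed from left to right; j is sent  *)
(* to the (k j + 1)-th of those elements y of the list t that satisfy r j y   *)
(* and have not been chosen yet.  (The value j is returned if there is no     *)
(* such element, which does not occur in the use made of greedy below, see    *)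
(* PhiSZ_tops_ok and PhiSZ_nontops_ok.)                                       *)
Fixpoint greedy (T : eqType) (r : rel T) (k : T -> nat) (js t : seq T) :
    T -> T :=
  if js is j :: js' then
    let x := nth j [seq y <- t | r j y] (k j) in
    [eta greedy r k js' (rem x t) with j |-> x]
  else id.

(* The enumeration enum A of a set of ordinals A is increasing. *)
Definition PhiSZ_fun n (s : 'S_n) (j : 'I_n) : 'I_n :=
  let F := descent_tops s in
  let F' := descent_bottoms s in
  if j \in F then
    greedy (fun i y : 'I_n => y < i) (vinc31_2_at s) (enum F) (rev (enum F')) j
  else
    greedy (fun i y : 'I_n => i <= y) (vinc31_2_at s)
      (rev (enum (~: F))) (enum (~: F')) j.

(* If every element to be processed has enough candidates left, then all the  *)
(* choices exist and are distinct.                                            *)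
Lemma greedy_ok (T : eqType) (r : rel T) (k : T -> nat) (js t : seq T) :
  uniq js -> uniq t ->
  {in js, forall j, index j js + k j < count (r j) t} ->
  {in js, forall j, greedy r k js t j \in t /\ r j (greedy r k js t j)} /\
  {in js &, injective (greedy r k js t)}.
Proof.
elim: js t => [|a js IH] t //= /andP[aNjs ujs] ut H.
set x := nth a _ _.
have /(_ (mem_head _ _)) := H a; rewrite eqxx add0n => Ha.
have : x \in [seq y <- t | r a y] by rewrite mem_nth // size_filter.
rewrite mem_filter => /andP[rax xt].
have [|IH1 IH2] := IH (rem x t) ujs (rem_uniq _ ut).
  move=> j jjs; have := H j; rewrite inE jjs orbT => /(_ isT).
  have /negbTE-> : a != j by apply: contraNneq aNjs => ->.
  rewrite addSn (seq.permP (perm_to_rem xt)) /=.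
  by case: (r j x) => /=; rewrite ?add0n ?add1n ?ltnS // => /ltnW.
have inr j : j \in js -> greedy r k js (rem x t) j \in t.
  by case/IH1 => /mem_rem.
have nx j : j \in js -> greedy r k js (rem x t) j != x.
  by move=> /IH1[]; rewrite (mem_rem_uniq x ut) inE => /andP[].
split=> [j|j1 j2]; rewrite !inE.
  have [-> _|_ /= jjs] := eqVneq j a; first by [].
  by split; [exact: inr | case: (IH1 _ jjs)].
have [->|_] := eqVneq j1 a; have [->|_] //= := eqVneq j2 a.
- by move=> _ /nx/eqP nxj /esym.
- by move=> /nx/eqP nxj.
- by exact: IH2.
Qed.

Lemma index_sorted_count (T : eqType) (r : rel T) (t : seq T) (x : T) :
  irreflexive r -> transitive r -> sorted r t -> x \in t ->
  index x t = count (r ^~ x) t.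
Proof.
move=> rirr rtr; elim: t => //= a t IH; rewrite path_sortedE //.
case/andP=> /allP at_ st; rewrite inE; have [-> _|xa /= xt] := eqVneq x a.
  rewrite rirr add0n; apply/esym/eqP; rewrite -leqn0 leqNgt -has_count.
  apply/hasP => -[y yt]; move/at_: (yt) => ay ya.
  by have := rtr _ _ _ ay ya; rewrite rirr.
by rewrite (at_ _ xt) add1n IH.
Qed.

Lemma sorted_enum_ord n (A : {set 'I_n}) :
  sorted (fun i j : 'I_n => i < j) (enum A).
Proof.
rewrite {1}/enum_mem; apply: sorted_filter; 
  first by move=> y x z; apply: ltn_trans.
have : sorted ltn (map val (enum 'I_n)) by rewrite val_enum_ord iota_ltn_sorted.
rewrite sorted_map; rewrite -enumT; exact.
Qed.

Lemma count_enum_set (T : finType) (A : {set T}) (a : pred T) :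
  count a (enum A) = #|[set x in A | a x]|.
Proof.
rewrite -size_filter cardE; apply: perm_size; apply: uniq_perm.
- by rewrite filter_uniq // enum_uniq.
- exact: enum_uniq.
- by move=> x; rewrite mem_filter !mem_enum inE andbC.
Qed.

Section WellDefined.
Variables (n : nat) (s : 'S_n).

Lemma consecutive_inj1 : {in consecutive n &, injective fst}.
Proof.
move=> [i j] [i' j']; rewrite !inE /= => /eqP Hj /eqP Hj' eqi.
by subst i'; congr pair; apply: val_inj; rewrite /= Hj Hj'.
Qed.

Lemma consecutive_inj2 : {in consecutive n &, injective snd}.
Proof.
move=> [i j] [i' j']; rewrite !inE /= => /eqP Hj /eqP Hj' eqj.
by subst j'; congr pair; apply: val_inj; move: Hj'; rewrite /= Hj => -[].
Qed.

Lemma card_tops (a : pred 'I_n) :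
  #|[set x in descent_tops s | a x]| = #|[set p in descents s | a (s p.1)]|.
Proof.
rewrite -(@card_in_imset _ _ (fun p => s p.1)
  (mem [set p in descents s | a (s p.1)])).
  apply: eq_card => x; rewrite inE; apply/andP/imsetP.
    by case=> /imsetP[p pd ->] ap; exists p; rewrite // inE pd.
  by case=> p; rewrite inE => /andP[pd ap] ->; rewrite imset_f.
move=> p p'; rewrite !inE => /andP[/andP[pc _] _] /andP[/andP[pc' _] _].
by move=> /perm_inj; apply: consecutive_inj1; rewrite inE.
Qed.

Lemma card_bottoms (a : pred 'I_n) :
  #|[set x in descent_bottoms s | a x]| = #|[set p in descents s | a (s p.2)]|.
Proof.
rewrite -(@card_in_imset _ _ (fun p => s p.2)
  (mem [set p in descents s | a (s p.2)])).
  apply: eq_card => x; rewrite inE; apply/andP/imsetP.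
    by case=> /imsetP[p pd ->] ap; exists p; rewrite // inE pd.
  by case=> p; rewrite inE => /andP[pd ap] ->; rewrite imset_f.
move=> p p'; rewrite !inE => /andP[/andP[pc _] _] /andP[/andP[pc' _] _].
by move=> /perm_inj; apply: consecutive_inj2; rewrite inE.
Qed.

Lemma vinc31_2_at_le (l : 'I_n) :
  vinc31_2_at s l <= #|[set p in descents s | (s p.2 < l) && (l < s p.1)]|.
Proof.
apply/subset_leq_card/subsetP => p; rewrite !inE.
by case/andP=> -> /and3P[_ h1 h2]; rewrite (ltn_trans h1 h2) h1 h2.
Qed.

Lemma PhiSZ_tops_ok (j : 'I_n) : j \in descent_tops s ->
  index j (enum (descent_tops s)) + vinc31_2_at s j <
    count (fun y : 'I_n => y < j) (rev (enum (descent_bottoms s))).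
Proof.
move=> jF; rewrite count_rev count_enum_set card_bottoms.
rewrite (@index_sorted_count _ (fun i j : 'I_n => i < j)); first last.
- by rewrite mem_enum.
- exact: sorted_enum_ord.
- by move=> y x z; apply: ltn_trans.
- by move=> x; rewrite ltnn.
rewrite count_enum_set card_tops.
apply: leq_ltn_trans (leq_add (leqnn _) (vinc31_2_at_le j)) _.
case/imsetP: jF => p0 p0d jE.
set A := [set p in _ | _]; set B := [set p in _ | _]; set C := [set p in _ | _].
have dAB : A :&: B = set0.
  apply/setP => p; rewrite !inE.
  by case: (ltngtP (s p.1) j); rewrite ?andbF.
have := cardsUI A B; rewrite dAB cards0 addn0 => <-.
apply: proper_card; apply/properP; split.
  apply/subsetP => p; rewrite !inE => /orP[|] /andP[/andP[-> h]] //.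
    by move=> h'; rewrite h (ltn_trans h h').
  by case/andP=> -> _; rewrite h.
exists p0; first by move: p0d; rewrite !inE jE => /andP[-> ->].
by rewrite !inE jE ltnn !andbF.
Qed.

Lemma PhiSZ_nontops_ok (j : 'I_n) : j \notin descent_tops s ->
  index j (rev (enum (~: descent_tops s))) + vinc31_2_at s j <
    count (fun y : 'I_n => j <= y) (enum (~: descent_bottoms s)).
Proof.
move=> jF; rewrite count_enum_set.
rewrite (@index_sorted_count _ (fun i j : 'I_n => j < i)); first last.
- by rewrite mem_rev mem_enum inE.
- by rewrite rev_sorted; apply: sorted_enum_ord.
- by move=> y x z h1 h2; apply: ltn_trans h1.
- by move=> x; rewrite ltnn.
rewrite count_rev count_enum_set.
have splitC (A : {set 'I_n}) (a : pred 'I_n) :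
    #|[set x in ~: A | a x]| + #|[set x in A | a x]| = #|[set x | a x]|.
  rewrite -(cardsID A [set x | a x]) addnC; congr (_ + _); apply: eq_card => x;
  by rewrite !inE andbC.
have E1 := splitC (descent_tops s) (fun x : 'I_n => j < x).
have E2 := splitC (descent_bottoms s) (fun x : 'I_n => j <= x).
have E3 : #|[set x : 'I_n | j <= x]| = #|[set x : 'I_n | j < x]|.+1.
  rewrite (cardsD1 j) inE leqnn add1n; congr S; apply: eq_card => x.
  by rewrite !inE ltn_neqAle -(inj_eq val_inj) eq_sym.
have E4 : #|[set x in descent_bottoms s | j <= x]| + vinc31_2_at s j <=
          #|[set x in descent_tops s | j < x]|.
  rewrite card_bottoms card_tops.
  apply: leq_trans (leq_add (leqnn _) (vinc31_2_at_le j)) _.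
  set A := [set p in _ | _]; set B := [set p in _ | _].
  have dAB : A :&: B = set0.
    by apply/setP => p; rewrite !inE; case: (leqP j (s p.2)); rewrite ?andbF.
  have := cardsUI A B; rewrite dAB cards0 addn0 => <-.
  apply/subset_leq_card/subsetP => p; rewrite !inE => /orP[|] /andP[/andP[-> h]].
    by move=> h'; rewrite h (leq_ltn_trans h' h).
  by case/andP=> _ ->; rewrite h.
rewrite -(ltn_add2r #|[set x in descent_bottoms s | j <= x]|) E2 E3 -E1.
by rewrite ltnS -addnA leq_add2l addnC.
Qed.

Lemma PhiSZ_fun_inj : injective (PhiSZ_fun s).
Proof.
have [] := @greedy_ok _ (fun i y : 'I_n => y < i) (vinc31_2_at s)
  (enum (descent_tops s)) (rev (enum (descent_bottoms s))).
- exact: enum_uniq.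
- by rewrite rev_uniq enum_uniq.
- by move=> j; rewrite mem_enum => /PhiSZ_tops_ok.
move=> P1 I1.
have [] := @greedy_ok _ (fun i y : 'I_n => i <= y) (vinc31_2_at s)
  (rev (enum (~: descent_tops s))) (enum (~: descent_bottoms s)).
- by rewrite rev_uniq enum_uniq.
- exact: enum_uniq.
- by move=> j; rewrite mem_rev mem_enum inE => /PhiSZ_nontops_ok.
move=> P2 I2.
have disj i j : i \in descent_tops s -> j \notin descent_tops s ->
    PhiSZ_fun s i != PhiSZ_fun s j.
  move=> iF jF; rewrite /PhiSZ_fun iF (negbTE jF).
  have [|+ _] := P1 i; first by rewrite mem_enum.
  have [|+ _] := P2 j; first by rewrite mem_rev mem_enum inE.
  rewrite mem_rev !mem_enum in_setC => jF' iF'.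
  by apply: contraNneq jF' => <-.
move=> j1 j2; have [h1|h1] := boolP (j1 \in descent_tops s);
  have [h2|h2] := boolP (j2 \in descent_tops s).
- by rewrite /PhiSZ_fun h1 h2; apply: I1; rewrite mem_enum.
- by move/eqP; rewrite (negbTE (disj _ _ h1 h2)).
- by move/esym/eqP; rewrite (negbTE (disj _ _ h2 h1)).
- rewrite /PhiSZ_fun (negbTE h1) (negbTE h2).
  by apply: I2; rewrite mem_rev mem_enum inE.
Qed.

End WellDefined.

Definition PhiSZ n (s : 'S_n) : 'S_n := perm (@PhiSZ_fun_inj n s).

(* With a = i + 1, the letter n - a is the ordinal n - i - 2. *)
Lemma hat_proof n (i : 'I_n) : (if i.+1 < n then n - i.+2 else i) < n.
Proof.
by case: ifP => _ //; rewrite ltn_subrL (leq_ltn_trans _ (ltn_ord i)).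
Qed.

Definition hat n (i : 'I_n) : 'I_n := Ordinal (hat_proof i).

Lemma hat_inj n : injective (@hat n).
Proof.
apply: (can_inj (g := @hat n)) => i; apply: val_inj => /=.
have [lin|nli] := ltnP i.+1 n; last by rewrite ltnNge nli.
rewrite -subSn // subSS ltn_subrL (leq_ltn_trans _ lin) //=.
by rewrite -subSn // subKn // ltnW.
Qed.

Lemma theta_hat_inj n (s : 'S_n) : injective (fun i => hat (s (rev_ord i))).
Proof. by move=> i j /hat_inj/perm_inj/rev_ord_inj. Qed.

Definition theta_hat n (s : 'S_n) : 'S_n := perm (@theta_hat_inj n s).

(* finv f is the inverse of f when f is injective.  An involutive phi_hat     *)
(* forces PhiSZ to be injective, hence finv (@PhiSZ n) to be its inverse.     *)
Definition phi_hat n (s : 'S_n) : 'S_n :=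
  finv (@PhiSZ n) (theta_hat (PhiSZ s)).

Definition P_gf (R : comNzRingType) (n : nat) (p q r s : R) : R :=
  (\sum_(t : 'S_n) p ^+ vinc13_2 t * q ^+ vinc31_2 t *
                   r ^+ vinc2_13 t * s ^+ vinc2_31 t)%R.

(* Main.v *)
Require Import Defs.
From mathcomp Require Import all_boot all_fingroup all_algebra.
From mathcomp Require Import zify.
Set Implicit Arguments.
Unset Strict Implicit.
Unset Printing Implicit Defensive.

(** Let [t] be the image of [s] under [PhiSZ], drawn as the arc diagram with an
arc from [j] to [t j] for every [j].  The descent tops of [s] are exactly the
[j] with [t j < j] (lower arcs), and [PhiSZ] sends them onto the descent
bottoms (lemmas [PhiSZ_lower], [PhiSZ_bottom]).  In the greedy construction,
the number of candidates skipped at [j] is the number of arcs that cross the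
arc of [j] on one prescribed side, and the number of candidates left over is
the number of arcs that nest with it on one prescribed side.  Hence, letter by
letter, 31-2 of [s] is a crossing number of [t] ([PhiSZ_cros]) and 2-31 of [s]
is a nesting number of [t] ([PhiSZ_nest]); the second follows from the first
because 31-2 and 2-31 together count all descents that jump over a given
letter ([crossing_descents]).

The statistic 2-13 is not read off directly, but after a letter [l] the word
jumps up over [l] as often as it jumps down over [l], up to a correction that
depends on whether [l] is a descent top and on which side of [l] the last
letter [m] of [s] lies ([up_down_crossings]).  The letter [m] is visible in
[t]: it is the one sent to the maximum ([PhiSZ_last]).

The map [theta_hat] rotates the diagram by a half-turn, shifted by one, which
exchanges lower and upper arcs, except for the arc ending at the maximum.  It
preserves the crossing numbers ([cros_theta]), and it changes the nesting
numbers by exactly the correction found above ([nest_theta]), since only the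
exceptional arc gains or loses nestings.  Therefore [phi_hat] carries 31-2 of
the letter [l] to 31-2 of the opposite letter, and 2-13 of [l] to 2-31 of the
opposite letter.  That 2-31 goes to 2-13 then follows because [phi_hat] is an
involution.

For the latter, [PhiSZ] has to be injective ([PhiSZ_inj]): [t] determines the
descent tops, the descent bottoms and the numbers 31-2 of all letters, and
these determine [s] by inserting the letters in increasing order into the
sequence of maximal blocks of consecutive smaller letters. *)

Lemma card_set_sum (T : finType) (A : {set T}) (P : pred T) :
  #|[set x in A | P x]| = \sum_(x in A) (P x : nat).
Proof.
rewrite -sum1_card big_mkcond [RHS]big_mkcond; apply: eq_bigr => x _ /=.
by rewrite inE; case: (x \in A); case: (P x).
Qed.

Lemma card_setT_sum (T : finType) (P : pred T) :
  #|[set x | P x]| = \sum_x (P x : nat).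
Proof.
by rewrite -sum1dep_card big_mkcond /=; apply: eq_bigr => x _; case: (P x).
Qed.

(** * The greedy choice counts candidates that are chosen later *)

Section Greedy.
Variables (T : eqType) (r : rel T) (k : T -> nat).

Let fits (js t : seq T) :=
  {in js, forall j, index j js + k j < count (r j) t}.

Lemma greedy_perm (js t : seq T) :
  uniq js -> uniq t -> size js = size t -> fits js t ->
  perm_eq [seq greedy r k js t j | j <- js] t.
Proof.
move=> ujs ut sz /(greedy_ok ujs ut)[gin ginj].
have ug : uniq [seq greedy r k js t j | j <- js] by rewrite map_inj_in_uniq.
have sub : {subset [seq greedy r k js t j | j <- js] <= t}.
  by move=> _ /mapP[j /gin[? _] ->].
by apply: uniq_perm => //; apply: (uniq_min_size ug sub _).2; rewrite size_map sz.
Qed.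

(** When everything in [t] is eventually chosen, the [k j] candidates skipped
at step [j] are themselves the choices made for some elements processed after
[j].  So [k j] counts those later elements [i] whose choice was eligible for
[j] and precedes the choice of [j].  Here [S] is the order of processing and
[R] the order of the list of candidates. *)
Lemma greedy_rank (S R : rel T) (js t : seq T) :
  irreflexive R -> transitive R -> sorted R t ->
  irreflexive S -> transitive S -> sorted S js ->
  uniq js -> uniq t -> size js = size t -> fits js t ->
  {in js, forall j, k j = count (fun i => let g := greedy r k js t in
     [&& r j (g i), R (g i) (g j) & ~~ S i j]) js}.
Proof.
move=> Rirr Rtr st Sirr Str; elim: js t st => //= a js IH t st ss.
move=> /andP[aNjs ujs] ut sz fit.
have pg := greedy_perm (js := a :: js) _ ut sz fit; rewrite /= aNjs ujs in pg.
move: pg => /(_ isT); set x := nth a _ _; rewrite eqxx.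
have /(_ (mem_head _ _)) := fit a; rewrite /= eqxx add0n => Ha.
have xf : x \in [seq y <- t | r a y] by rewrite mem_nth // size_filter.
have xt : x \in t by move: xf; rewrite mem_filter => /andP[].
have Sa i : i \in js -> S a i.
  by move: ss; rewrite path_sortedE // => /andP[/allP h _] /h.
have ff : fits js (rem x t).
  move=> j jjs; have := fit j; rewrite inE jjs orbT => /(_ isT) /=.
  have /negbTE-> : a != j by apply: contraNneq aNjs => ->.
  rewrite addSn (seq.permP (perm_to_rem xt)) /=.
  by case: (r j x) => /=; rewrite ?add0n ?add1n ?ltnS // => /ltnW.
have {}IH := IH (rem x t) _ _ ujs (rem_uniq x ut) _ ff.
move=> pg j; rewrite inE /=; have [-> _ | ja /= jjs] := eqVneq j a.
  rewrite Rirr !andbF add0n.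
  have -> : k a = count (R^~ x) [seq y <- t | r a y].
    rewrite -index_sorted_count //; last exact: sorted_filter.
    by rewrite index_uniq ?size_filter // filter_uniq.
  rewrite count_filter -(seq.permP pg) /= Rirr /= count_map.
  apply: eq_in_count => i ijs /=; rewrite (_ : i == a = false); last first.
    by apply: contraNF aNjs => /eqP <-.
  rewrite (_ : S i a = false) ?andbT 1?andbC //.
  by apply/negP => /(Str _ _ _ (Sa _ ijs)); rewrite Sirr.
rewrite (Sa _ jjs) !andbF add0n IH //=.
- apply: eq_in_count => i ijs; rewrite (_ : i == a = false) //.
  by apply: contraNF aNjs => /eqP <-.
- by apply: (subseq_sorted Rtr _ st); apply: rem_subseq.
- exact: path_sorted ss.
- by rewrite size_rem // -sz.
Qed.

End Greedy.

(** * Adjacent letters on both sides of a given letter *)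

Section Pairs.
Variables (n : nat) (s : 'S_n).
Implicit Types (l a : 'I_n) (p : 'I_n * 'I_n).

Lemma descentsP p :
  reflect (p.2 = p.1.+1 :> nat /\ s p.2 < s p.1) (p \in descents s).
Proof.
by rewrite !inE; apply: (iffP andP) => -[/eqP h1 h2]; split=> //; apply/eqP.
Qed.

Lemma pos_eq (i l : 'I_n) : ((s^-1)%g l == i :> nat) = (s i == l :> nat).
Proof.
apply/eqP/eqP => [/val_inj <-|/val_inj <-]; first by rewrite permKV.
by rewrite permK.
Qed.

Lemma vinc31_2_desc l : vinc31_2_at s l =
  \sum_(p in descents s) [&& p.2 < (s^-1)%g l, s p.2 < l & l < s p.1].
Proof.
rewrite -card_set_sum; apply: eq_card => p; rewrite !inE.
case: ((p.2 : nat) == p.1.+1) => //=.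
by apply/idP/idP => [/and3P[-> h1 h2]|/andP[_ ->]] //;
  rewrite h1 h2 (ltn_trans h1).
Qed.

Lemma vinc2_31_desc l : vinc2_31_at s l =
  \sum_(p in descents s) [&& (s^-1)%g l < p.1, s p.2 < l & l < s p.1].
Proof.
rewrite -card_set_sum; apply: eq_card => p; rewrite !inE.
case: ((p.2 : nat) == p.1.+1) => //=.
by apply/idP/idP => [/and3P[-> h1 h2]|/andP[_ ->]] //;
  rewrite h1 h2 (ltn_trans h1).
Qed.

(** A descent that jumps over [l] lies entirely before or entirely after [l],
so its pair of letters contributes to 31-2 or to 2-31.  The descents whose
bottom is less than [l] are those that jump over [l] and those whose top is at
most [l]. *)
Lemma crossing_descents l :
  vinc31_2_at s l + vinc2_31_at s l + #|[set x in descent_tops s | x <= l]|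
  = #|[set x in descent_bottoms s | x < l]|.
Proof.
rewrite vinc31_2_desc vinc2_31_desc (card_tops s (fun x : 'I_n => x <= l)).
rewrite (card_bottoms s (fun x : 'I_n => x < l)).
rewrite !card_set_sum -!big_split; apply: eq_bigr => p /descentsP[c d] /=.
move: c d (pos_eq p.1 l) (pos_eq p.2 l).
move: (nat_of_ord p.1) (nat_of_ord p.2) (nat_of_ord l) (nat_of_ord (s p.1)).
by move: (nat_of_ord (s p.2)) (nat_of_ord ((s^-1)%g l)); lia.
Qed.

Lemma descent_topP l : reflect
  (exists2 p, p \in descents s & p.1 = (s^-1)%g l) (l \in descent_tops s).
Proof.
apply: (iffP imsetP) => -[p pd e]; exists p => //; first by rewrite e permK.
by rewrite e permKV.
Qed.

Lemma descent_between (P : pred 'I_n) (i j : 'I_n) : i < j -> P i -> ~~ P j ->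
  exists p, [/\ p.2 = p.1.+1 :> nat, i <= p.1, p.2 <= j, P p.1 & ~~ P p.2].
Proof.
move: j => [j jn] /=; elim: j jn => // j IH jn ij Pi Pj.
have jn' : j < n by lia.
have [Pj'|Pj'] := boolP (P (Ordinal jn')).
  by exists (Ordinal jn', Ordinal jn); split.
have [|p [? ? ? ? ?]] := IH jn' _ Pi Pj'; last by exists p; split=> //; lia.
by move: ij; rewrite ltnS leq_eqVlt => /orP[/eqP e|//]; case/negP: Pj';
   rewrite (_ : Ordinal jn' = i) //; apply: val_inj.
Qed.

End Pairs.

Section Word.
Variables (n : nat) (s : 'S_n.+1).
Implicit Types (l : 'I_n.+1) (p : 'I_n.+1 * 'I_n.+1).

(** Upward and downward changes of a 0-1 sequence alternate, so their numbers
differ by the difference of its end values. *)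
Lemma crossing_count (b : nat -> bool) i j : i <= j ->
  \sum_(i <= k < j) (~~ b k && b k.+1 : nat) + b i =
  \sum_(i <= k < j) (b k && ~~ b k.+1 : nat) + b j.
Proof.
move=> /subnKC <-; elim: (j - i) => [|m IH]; first by rewrite !addn0 !big_geq.
by rewrite addnS !big_nat_recr ?leq_addr //=; lia.
Qed.

Lemma card_consecutive (P : nat -> nat -> bool)
    (Q : pred ('I_n.+1 * 'I_n.+1)) l :
  (forall p, p \in consecutive n.+1 -> Q p = (l < p.1) && P p.1 p.2) ->
  #|[set p in consecutive n.+1 | Q p]| = \sum_(l.+1 <= k < n) (P k k.+1 : nat).
Proof.
move=> QE; rewrite card_set_sum.
have -> : \sum_(p in consecutive n.+1) (Q p : nat) =
    \sum_(i < n.+1) \sum_(j < n.+1)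
      (((j : nat) == i.+1) && (l < i) && P i j : nat).
  rewrite pair_big big_mkcond /=; apply: eq_bigr => p _.
  by have := QE p; rewrite inE; case: eqP => //= _ /(_ isT) ->.
transitivity (\sum_(i < n.+1) ((i < n) && (l < i) && P i i.+1 : nat)).
  apply: eq_bigr => i _; have [lt|ge] := ltnP i n.
    rewrite (bigD1 (Ordinal (lt : i.+1 < n.+1))) //= eqxx big1 ?addn0 // => j.
    by rewrite -val_eqE /= => /negbTE ->.
  by rewrite big1 // => j _; have := ltn_ord j; lia.
rewrite big_ord_recr /= ltnn addn0.
rewrite big_geq_mkord [RHS]big_mkcond /=; apply: eq_bigr => i _.
by rewrite ltn_ord; case: (l < i).
Qed.

Lemma descent_top_next l (ln : (s^-1)%g l < n) :
  (l \in descent_tops s) = (s (inord ((s^-1)%g l).+1) < l).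
Proof.
have v : (inord ((s^-1)%g l).+1 : 'I_n.+1) = ((s^-1)%g l).+1 :> nat.
  by rewrite inordK.
apply/descent_topP/idP => [[p /descentsP[c d] e]|d].
  rewrite (_ : inord _ = p.2); first by rewrite e permKV in d.
  by apply: val_inj; rewrite /= v -e c.
exists ((s^-1)%g l, inord ((s^-1)%g l).+1) => //.
by apply/descentsP; rewrite permKV.
Qed.

Lemma last_letter_not_top : s ord_max \notin descent_tops s.
Proof.
apply/descent_topP => -[p /descentsP[c _]]; rewrite permK => e.
by have := ltn_ord p.2; rewrite c e ltnn.
Qed.

(** After [l], whether the word jumps more often up or down over [l] depends
only on the sides of [l] on which the next letter and the last letter lie; the
next letter is smaller than [l] exactly when [l] is a descent top. *)
Lemma up_down_crossings l :
  vinc2_13_at s l + ((l \notin descent_tops s) && (s ord_max < l)) =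
  vinc2_31_at s l + ((l \in descent_tops s) && (l < s ord_max)).
Proof.
pose b k := l < s (inord k).
pose U k k' := ~~ b k && b k'; pose D k k' := b k && ~~ b k'.
have ne (i : 'I_n.+1) : (s^-1)%g l < i -> s i != l :> nat.
  by move=> li; rewrite -pos_eq; apply: contraTneq li => ->; rewrite ltnn.
have e13 : vinc2_13_at s l = \sum_(((s^-1)%g l).+1 <= k < n) (U k k.+1 : nat).
  apply: card_consecutive => -[i j]; rewrite inE /= => /eqP c.
  rewrite /U /b !inord_val; case: ltnP => //= li.
  by rewrite -leqNgt ltn_neqAle ne.
have e31 : vinc2_31_at s l = \sum_(((s^-1)%g l).+1 <= k < n) (D k k.+1 : nat).
  apply: card_consecutive => -[i j]; rewrite inE /= => /eqP c.
  rewrite /D /b !inord_val; case: ltnP => //= li.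
  by rewrite -leqNgt andbC [s j < l]ltn_neqAle (ne j) // c ltnW.
(* If l is not the last letter, b starts right after l and ends at m. *)
rewrite {}e13 {}e31; have [ln|nl] := ltnP ((s^-1)%g l) n.
  have bn : b n = (l < s ord_max).
    by rewrite /b (_ : inord n = ord_max) //; apply: val_inj; rewrite /= inordK.
  have bp : b ((s^-1)%g l).+1 = (l \notin descent_tops s).
    rewrite descent_top_next // -leqNgt /b ltn_neqAle eq_sym ne //.
    by rewrite inordK.
  have := crossing_count b ln; have := ne ord_max ln; rewrite bn bp /U /D.
  move: (\sum_(_ <= _ < _) _) (\sum_(_ <= _ < _) _) => x y.
  by case: (l \in descent_tops s) => /=; case: ltngtP => //= _ _; lia.
have -> : l = s ord_max.
  apply: (@perm_inj _ (s^-1)%g); rewrite permK; apply: val_inj => /=.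
  by apply/eqP; rewrite eqn_leq nl -ltnS ltn_ord.
by rewrite permK !ltnn !andbF !big_geq.
Qed.

Lemma last_letter_no_nest : vinc2_31_at s (s ord_max) = 0.
Proof.
apply: eq_card0 => p; rewrite !inE permK.
by have := ltn_ord p.1; rewrite ltnS ltnNge /= => ->; rewrite !andbF.
Qed.

End Word.

(** * Crossings and nestings of a permutation *)

Section Arcs.
Variables (n : nat) (t : 'S_n).
Implicit Types i j : 'I_n.

(** A lower arc is counted with the crossing arcs that start further out to
the right, an upper arc with the crossing arcs that start further to the left;
summed over [j], every crossing is counted once.  An upper arc that ends where
another one starts crosses it, a lower one does not. *)
Definition cros_at j :=
  if t j < j then #|[set i : 'I_n | [&& j < i, t j < t i & t i < j]]|
  else #|[set i : 'I_n | [&& i < j, j <= t i & t i < t j]]|.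

(** Only the arcs that contain the arc of [j] are counted, so every nesting is
counted once.  For a lower arc, [t i < t j < j < i] makes [i] lower as well;
for an upper arc, [i < j <= t j < t i] makes it upper. *)
Definition nest_at j :=
  if t j < j then #|[set i : 'I_n | (j < i) && (t i < t j)]|
  else #|[set i : 'I_n | (i < j) && (t j < t i)]|.

(** As many arcs pass from the left to the right of a cut as back, because [t]
is a bijection. *)
Lemma card_arcs_over j :
  #|[set i : 'I_n | (i < j) && (j <= t i)]| =
  #|[set i : 'I_n | (t i < j) && (j <= i)]|.
Proof.
rewrite !card_setT_sum.
apply: (@addIn (\sum_(i < n) ((i < j) && (t i < j) : nat))).
rewrite -!big_split /=.
transitivity (\sum_(i < n) (i < j : nat)).
  by apply: eq_bigr => i _; case: (i < j); case: (leqP j (t i)).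
rewrite (reindex_inj (@perm_inj _ t)); apply: eq_bigr => i _.
by case: (t i < j); case: (leqP j i).
Qed.

(** For a lower arc this splits the lower arcs over [j] according to their end
points; for an upper arc it does the same for the upper arcs over [j], which
are then exchanged for lower ones by [card_arcs_over]. *)
Lemma cros_nest j :
  cros_at j + nest_at j = #|[set i : 'I_n | (t i < j) && (j < i)]|.
Proof.
rewrite /cros_at /nest_at; have [lt|ge] := ltnP (t j) j.
  rewrite !card_setT_sum -big_split; apply: eq_bigr => i _ /=.
  have : (t i == t j :> nat) = (i == j :> nat).
    by rewrite !val_eqE (inj_eq perm_inj).
  move: lt; move: (nat_of_ord (t i)) (nat_of_ord (t j)) (nat_of_ord i).
  by move: (nat_of_ord j); lia.
transitivity #|[set i : 'I_n | (i < j) && (j <= t i)]|.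
  rewrite !card_setT_sum -big_split; apply: eq_bigr => i _ /=.
  have : (t i == t j :> nat) = (i == j :> nat).
    by rewrite !val_eqE (inj_eq perm_inj).
  move: ge; move: (nat_of_ord (t i)) (nat_of_ord (t j)) (nat_of_ord i).
  by move: (nat_of_ord j); lia.
rewrite card_arcs_over; apply: eq_card => i; rewrite !inE.
have [->|] := eqVneq i j; first by rewrite !ltnn ltnNge ge.
by rewrite [j <= i]leq_eqVlt eq_sym -(inj_eq val_inj) => /negbTE ->.
Qed.

End Arcs.

(** * Vincular statistics as crossings and nestings *)

Section PhiSZ_arcs.
Variables (n : nat) (s : 'S_n).
Implicit Types i j : 'I_n.
Local Notation F := (descent_tops s).
Local Notation F' := (descent_bottoms s).
Local Notation t := (PhiSZ s).

Let fitF : {in enum F, forall j, index j (enum F) + vinc31_2_at s j <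
   count (fun y : 'I_n => y < j) (rev (enum F'))}.
Proof. by move=> j; rewrite mem_enum => /PhiSZ_tops_ok. Qed.

Let fitG : {in rev (enum (~: F)), forall j,
   index j (rev (enum (~: F))) + vinc31_2_at s j <
   count (fun y : 'I_n => j <= y) (enum (~: F'))}.
Proof. by move=> j; rewrite mem_rev mem_enum inE => /PhiSZ_nontops_ok. Qed.

Lemma PhiSZ_top j : j \in F -> t j < j /\ t j \in F'.
Proof.
move=> jF; rewrite permE /PhiSZ_fun jF.
have [|+ _] := greedy_ok (enum_uniq _) _ fitF;
  first by rewrite rev_uniq enum_uniq.
by move=> /(_ j); rewrite mem_enum mem_rev mem_enum => /(_ jF)[].
Qed.

Lemma PhiSZ_nontop j : j \notin F -> j <= t j /\ t j \notin F'.
Proof.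
move=> jF; rewrite permE /PhiSZ_fun (negbTE jF).
have [|+ _] := greedy_ok _ (enum_uniq _) fitG;
  first by rewrite rev_uniq enum_uniq.
by move=> /(_ j); rewrite mem_rev !mem_enum !inE => /(_ jF)[].
Qed.

Lemma PhiSZ_lower j : (t j < j) = (j \in F).
Proof.
have [/PhiSZ_top[]|/PhiSZ_nontop[]] // := boolP (j \in F).
by rewrite leqNgt => /negbTE.
Qed.

Lemma PhiSZ_bottom j : (t j \in F') = (j \in F).
Proof.
have [/PhiSZ_top[]|/PhiSZ_nontop[_ /negbTE]] // := boolP (j \in F).
Qed.

Lemma card_tops_bottoms : #|F| = #|F'|.
Proof.
rewrite -(card_preimset F' (@perm_inj _ t)); apply: eq_card => j.
by rewrite inE PhiSZ_bottom.
Qed.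

(** The candidates skipped at [j] are the end points, between those of the arc
of [j], of arcs processed later: that is, arcs crossing it. *)
Lemma PhiSZ_cros j : vinc31_2_at s j = cros_at t j.
Proof.
have card_enum (A : {set 'I_n}) : size (enum A) = #|A| by rewrite cardE.
rewrite /cros_at PhiSZ_lower.
have [jF|jF] := boolP (j \in F).
  have := @greedy_rank _ _ _ (fun i k => i < k) (fun i k => k < i)
    _ _ _ _ _ _ _ _ _ _ _ fitF j.
  rewrite mem_enum jF => ->; rewrite ?size_rev ?card_enum ?rev_uniq ?enum_uniq //.
  - rewrite count_enum_set; apply: eq_card => i; rewrite !inE.
    have [iF|] := boolP (i \in F); last first.
      by rewrite -PhiSZ_lower; lia.
    rewrite !permE /PhiSZ_fun iF jF -leqNgt.
    have [->|] := eqVneq i j; first by rewrite !ltnn andbF.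
    rewrite [j <= i]leq_eqVlt eq_sym -(inj_eq val_inj) => /negbTE -> /=.
    by rewrite andbC; case: (j < i); rewrite ?andbF ?andbT //= andbC.
  - by move=> i; rewrite ltnn.
  - by move=> y x z h1 h2; apply: ltn_trans h1.
  - by rewrite rev_sorted; apply: sorted_enum_ord.
  - by move=> i; rewrite ltnn.
  - by move=> y x z; apply: ltn_trans.
  - exact: sorted_enum_ord.
  - exact: card_tops_bottoms.
have := @greedy_rank _ _ _ (fun i k => k < i) (fun i k => i < k)
    _ _ _ _ _ _ _ _ _ _ _ fitG j.
rewrite mem_rev mem_enum inE jF => ->;
  rewrite ?size_rev ?card_enum ?rev_uniq ?enum_uniq //.
- rewrite count_rev count_enum_set; apply: eq_card => i; rewrite !inE.
  have [iF|iF] := boolP (i \in F); first by move: iF; rewrite -PhiSZ_lower; lia.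
  rewrite !permE /PhiSZ_fun (negbTE iF) (negbTE jF) -leqNgt /=.
  have [->|] := eqVneq i j; first by rewrite !ltnn andbF.
  rewrite [i <= j]leq_eqVlt -(inj_eq val_inj) => /negbTE -> /=.
  by rewrite andbA andbC.
- by move=> i; rewrite ltnn.
- by move=> y x z; apply: ltn_trans.
- exact: sorted_enum_ord.
- by move=> i; rewrite ltnn.
- by move=> y x z h1 h2; apply: ltn_trans h1.
- by rewrite rev_sorted; apply: sorted_enum_ord.
- by apply: (@addnI #|F|); rewrite cardsC card_tops_bottoms cardsC.
Qed.

(** Both sides have the same sum with 31-2 of [j]: the number of descents that
jump over [j] equals the number of lower arcs over [j], because [PhiSZ s] maps
the descent tops onto the descent bottoms. *)
Lemma PhiSZ_nest j : vinc2_31_at s j = nest_at t j.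
Proof.
apply: (@addnI (cros_at t j)); rewrite -{1}PhiSZ_cros cros_nest.
apply: (@addIn #|[set x in F | x <= j]|); rewrite crossing_descents.
rewrite (card_set_sum F (fun x : 'I_n => x <= j)).
rewrite (card_set_sum F' (fun x : 'I_n => x < j)) card_setT_sum.
rewrite [X in _ + X]big_mkcond -big_split.
rewrite big_mkcond (reindex_inj (@perm_inj _ t)); apply: eq_bigr => i _ /=.
rewrite PhiSZ_bottom -PhiSZ_lower.
by case: ltnP; move: (nat_of_ord (t i)) (nat_of_ord i) (nat_of_ord j); lia.
Qed.

End PhiSZ_arcs.

(** Let [i] be the letter sent to the maximum; it is not a descent top.  If it
is below the last letter [m], its arc contains the arc of [m], although 2-31
of [m] is 0.  If it is above [m], the word goes up after [i] and has to come
down over [i] to reach [m], so 2-31 of [i] is positive, although no arc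
contains the arc of [i]. *)
Lemma PhiSZ_last n (s : 'S_n.+1) : PhiSZ s (s ord_max) = ord_max.
Proof.
set m := s ord_max; have [i im] : exists i, PhiSZ s i = ord_max.
  by exists ((PhiSZ s)^-1%g ord_max); rewrite permKV.
have iF : i \notin descent_tops s by rewrite -PhiSZ_lower im -ltnNge ltnS leq_ord.
have no_over j (k : 'I_n.+1) : vinc2_31_at s j = 0 -> j \notin descent_tops s ->
    k < j -> PhiSZ s k <= PhiSZ s j.
  rewrite PhiSZ_nest /nest_at PhiSZ_lower => + /negbTE jF kj.
  by rewrite jF => /eqP; rewrite cards_eq0 => /eqP/setP/(_ k);
     rewrite !inE kj /= ltnNge => /negbFE.
have [im'|im'|/val_inj <- //] := ltngtP i m.
  have := no_over _ _ (last_letter_no_nest s) (last_letter_not_top s) im'.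
  by rewrite im => h; apply/val_inj/eqP; rewrite eqn_leq h -ltnS ltn_ord.
have := up_down_crossings s i; rewrite iF im' (negbTE iF) /= addn0 addn1.
have -> // : vinc2_31_at s i = 0.
rewrite PhiSZ_nest /nest_at im /= ltnNge leq_ord /=.
by apply: eq_card0 => k; rewrite !inE; have := ltn_ord (PhiSZ s k); lia.
Qed.

(** * The half-turn of the arc diagram *)

Section ThetaHat.
Variable n : nat.
Implicit Types (t : 'S_n.+1) (i j m : 'I_n.+1).

Lemma val_hat i : hat i = (if i < n then n - i.+1 else i) :> nat.
Proof. by rewrite /= ltnS subSS. Qed.

Lemma hatK : involutive (@hat n.+1).
Proof.
move=> i; apply: val_inj; rewrite /= !ltnS !subSS.
case: (ltnP i n) => h; last by rewrite ltnNge h.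
by case: ltnP => ?; lia.
Qed.

Lemma theta_hatE t j : theta_hat t (rev_ord j) = hat (t j).
Proof. by rewrite permE rev_ordK. Qed.

Lemma theta_hatK : involutive (@theta_hat n.+1).
Proof.
by move=> t; apply/permP => j; rewrite -[j]rev_ordK !theta_hatE rev_ordK hatK.
Qed.

Lemma card_rev_ord (P : pred 'I_n.+1) :
  #|[set i | P i]| = #|[set i | P (rev_ord i)]|.
Proof. by rewrite !card_setT_sum (reindex_inj rev_ord_inj). Qed.

Lemma theta_hat_lower t j : t j < n ->
  (theta_hat t (rev_ord j) < rev_ord j) = (j <= t j).
Proof.
by move=> h; rewrite theta_hatE val_hat h /=; have := ltn_ord j; lia.
Qed.

Lemma theta_hat_last t j : t j = ord_max -> theta_hat t (rev_ord j) = ord_max.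
Proof. by move=> tj; rewrite theta_hatE tj; apply: val_inj; rewrite /= ltnn. Qed.

(** The half-turn makes [j] an upper arc and maps the lower arcs over [j] to
upper arcs; the weak inequality at the touching point of upper arcs absorbs
the shift by one in [hat]. *)
Lemma cros_theta_lower t j : t j < j ->
  cros_at (theta_hat t) (rev_ord j) = cros_at t j.
Proof.
move=> lt; have tn : t j < n by have := ltn_ord j; lia.
rewrite /cros_at theta_hat_lower // lt leqNgt lt /= card_rev_ord.
apply: eq_card => i; rewrite !inE !theta_hatE !val_hat tn /=.
have := ltn_ord j; have := ltn_ord i; have := ltn_ord (t i); move: lt tn.
move: (nat_of_ord (t i)) (nat_of_ord (t j)) (nat_of_ord i) (nat_of_ord j).
by move=> x y u v ? ? ? ? ?; case: (ltnP x n) => ?; lia.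
Qed.

(** Upper arcs that do not end at the maximum reduce to lower ones since
[theta_hat] is an involution.  The arc that ends at the maximum stays upper,
and is crossed by all upper arcs over its start; their number becomes the
number of lower arcs over it, which is the same by [card_arcs_over]. *)
Lemma cros_theta t j : cros_at (theta_hat t) (rev_ord j) = cros_at t j.
Proof.
have [lt|ge] := ltnP (t j) j; first exact: cros_theta_lower.
have [tn|tn] := ltnP (t j) n.
  rewrite -{2}[t]theta_hatK -{2}[j]rev_ordK; apply/esym/cros_theta_lower.
  by rewrite theta_hat_lower.
have tE : t j = ord_max by apply: val_inj => /=; have := ltn_ord (t j); lia.
rewrite /cros_at (theta_hat_last tE) tE !ltnNge !leq_ord /= card_rev_ord.
transitivity #|[set i : 'I_n.+1 | (i < j) && (j <= t i)]|; last first.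
  apply: eq_card => i; rewrite !inE.
  have := ltn_ord (t i); have [->|ij] := eqVneq i j; first by rewrite ltnn.
  have : (t i != t j :> nat) by rewrite (inj_eq val_inj) (inj_eq perm_inj).
  by rewrite tE /=; lia.
rewrite card_arcs_over; apply: eq_card => i; rewrite !inE !theta_hatE !val_hat /=.
have := ltn_ord j; have := ltn_ord i; have := ltn_ord (t i).
have [->|] := eqVneq i j; first by rewrite tE /=; lia.
rewrite -(inj_eq val_inj) /=.
move: (nat_of_ord (t i)) (nat_of_ord i) (nat_of_ord j).
by move=> x u v ? ? ? ?; case: (ltnP x n) => ?; lia.
Qed.

(** Besides the images of the lower arcs around [j], the arc that ends at the
maximum contains the new upper arc as soon as it starts further out. *)
Lemma nest_theta_lower t j m : t m = ord_max -> t j < j ->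
  nest_at (theta_hat t) (rev_ord j) = nest_at t j + (j < m).
Proof.
move=> tm lt; have tn : t j < n by have := ltn_ord j; lia.
have -> : (j < m : nat) = \sum_(i < n.+1) ((t i == n :> nat) && (j < i)).
  rewrite (bigD1 m) //= tm eqxx big1 ?addn0 // => i im.
  rewrite (_ : (t i == n :> nat) = false) //; apply/negbTE.
  by apply: contra im => /eqP e; apply/eqP/(@perm_inj _ t)/val_inj; rewrite tm.
rewrite /nest_at theta_hat_lower // lt leqNgt lt /= card_rev_ord.
rewrite !card_setT_sum -big_split; apply: eq_bigr => i _.
rewrite !theta_hatE !val_hat tn /=.
have := ltn_ord j; have := ltn_ord i; have := ltn_ord (t i); move: lt tn.
move: (nat_of_ord (t i)) (nat_of_ord (t j)) (nat_of_ord i) (nat_of_ord j).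
by move=> x y u v ? ? ? ? ?; case: (ltnP x n) => ?; lia.
Qed.

(** The arc from [m] to the maximum contains the upper arcs that start after
[m].  The half-turn makes them lower, so that they are no longer contained in
it; instead it then contains the images of the lower arcs that start before
[m].  The correction terms have the same shape as in [up_down_crossings]. *)
Lemma nest_theta t j m : t m = ord_max ->
  nest_at (theta_hat t) (rev_ord j) + (~~ (t j < j) && (m < j)) =
  nest_at t j + ((t j < j) && (j < m)).
Proof.
move=> tm; have [lt|ge] := ltnP (t j) j.
  by rewrite (nest_theta_lower tm) // addn0.
have [tn|tn] := ltnP (t j) n.
  have tm' : theta_hat t (rev_ord m) = ord_max.
    exact: theta_hat_last.
  have := @nest_theta_lower _ (rev_ord j) _ tm'.
  rewrite theta_hat_lower // theta_hatK rev_ordK => -> //.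
  by rewrite addn0; congr (_ + _); have := ltn_ord j; have := ltn_ord m => /=; lia.
have tE : t j = ord_max by apply: val_inj => /=; have := ltn_ord (t j); lia.
have <- : j = m by apply: (@perm_inj _ t); rewrite tm.
rewrite ltnn !andbF !addn0 /nest_at (theta_hat_last tE) tE.
rewrite [ord_max < _]ltnNge [ord_max < j]ltnNge !leq_ord /=.
rewrite !eq_card0 // => i; rewrite !inE; have := ltn_ord (t i).
  by lia.
by have := ltn_ord (theta_hat t i); lia.
Qed.

End ThetaHat.

(** * Recovering a word from its descent tops, descent bottoms and 31-2 *)

Section Injectivity.
Variables (n : nat) (s : 'S_n).
Implicit Types (l a : 'I_n) (p : 'I_n * 'I_n).
Local Notation F := (descent_tops s).
Local Notation F' := (descent_bottoms s).
Local Notation pos l := (nat_of_ord ((s^-1)%g l)).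

(** The letters less than [h] form maximal blocks of adjacent letters, and
every block begins with a descent bottom whose top is at least [h], except one
at the start of the word, if there is one.  For [a < h] this is the number of
the block that contains [a], where a block at the start has number 0. *)
Definition block_index (h : nat) a :=
  \sum_(p in descents s) [&& s p.2 < h, h <= s p.1 & p.2 <= pos a].

Lemma card_in_eq (A : {set 'I_n}) l :
  #|[set x in A | x == l :> nat]| = (l \in A).
Proof.
rewrite card_set_sum big_mkcond (bigD1 l) //= eqxx big1 ?addn0; first by case: ifP.
by move=> x; rewrite -(inj_eq val_inj) => /negbTE ->; rewrite if_same.
Qed.

Lemma sum_top l : \sum_(p in descents s) (s p.1 == l :> nat) = (l \in F).
Proof.
rewrite -card_set_sum -(card_tops s (fun x : 'I_n => x == l :> nat)).
exact: card_in_eq.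
Qed.

Lemma sum_bottom l : \sum_(p in descents s) (s p.2 == l :> nat) = (l \in F').
Proof.
rewrite -card_set_sum -(card_bottoms s (fun x : 'I_n => x == l :> nat)).
exact: card_in_eq.
Qed.

Lemma pos_neq l a : a < l -> pos a != pos l.
Proof.
move=> al; rewrite (inj_eq val_inj) (inj_eq perm_inj).
by apply: contraTneq al => ->; rewrite ltnn.
Qed.

(** The blocks of smaller letters that come before [l], except one at the start
of the word, are counted by 31-2 of [l].  If [l] is a descent bottom, it begins
one more such block; otherwise it continues the last of them or lies in a block
at the start of the word. *)
Lemma block_index_new l : block_index l.+1 l = vinc31_2_at s l + (l \in F').
Proof.
rewrite vinc31_2_desc -sum_bottom -big_split; apply: eq_bigr => p /descentsP[c d].
have := pos_eq s p.1 l; have := pos_eq s p.2 l; move: c d => /=.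
move: (nat_of_ord p.1) (nat_of_ord p.2) (nat_of_ord l) (nat_of_ord (s p.1)).
by move: (nat_of_ord (s p.2)) (pos l); lia.
Qed.

(** Among the blocks to its right, [l] shifts the numbers up when it begins a
block and down when it is joined to the next block, which happens when it is a
descent top. *)
Lemma block_index_step l a : a < l ->
  block_index l.+1 a + (pos l < pos a) * (l \in F) =
  block_index l a + (pos l < pos a) * (l \in F').
Proof.
move/pos_neq; rewrite -sum_bottom -sum_top !big_distrr -!big_split => al /=.
apply: eq_bigr => p /descentsP[c d].
have := pos_eq s p.1 l; have := pos_eq s p.2 l; move: c d al => /=.
move: (nat_of_ord p.1) (nat_of_ord p.2) (nat_of_ord l) (nat_of_ord (s p.1)).
move: (nat_of_ord (s p.2)) (pos l) (pos a) => x y z u v w r.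
by case: (ltnP y z); lia.
Qed.

(** The blocks that come before [l] have numbers up to 31-2 of [l].  If [a]
comes after [l], then between them the word descends from a letter that is at
least [l] to a smaller one, which begins one more block. *)
Lemma block_index_pos l a : a < l ->
  (vinc31_2_at s l < block_index l a) = (pos l < pos a).
Proof.
move=> al; have ne := pos_neq al; rewrite vinc31_2_desc.
have [la|] := ltnP (pos l) (pos a); last first.
  rewrite leq_eqVlt (negbTE ne) /= => la.
  apply/negbTE; rewrite -leqNgt; apply: leq_sum => p /descentsP[c d].
  have := pos_eq s p.1 l; have := pos_eq s p.2 l; move: c d la => /=.
  move: (nat_of_ord p.1) (nat_of_ord p.2) (nat_of_ord l) (nat_of_ord (s p.1)).
  by move: (nat_of_ord (s p.2)) (pos l) (pos a); lia.
have [||p0 [c0 h1 h2 h3 h4]] := @descent_between n (fun i => l <= s i) _ _ la.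
- by rewrite permKV.
- by rewrite permKV -ltnNge.
have p0d : p0 \in descents s by apply/descentsP; split=> //; lia.
have -> : forall k, (k < block_index l a) =
    (k + \sum_(p in descents s) (p == p0) <= block_index l a).
  move=> k; rewrite (bigD1 p0) //= eqxx big1 ?addn0 ?addn1 //.
  by move=> p /andP[_ /negbTE ->].
rewrite -big_split /=; apply: leq_sum => p /descentsP[c d].
have [->|_] := eqVneq p p0.
  move: c0 h1 h2 h3 h4 => /=.
  move: (nat_of_ord p0.1) (nat_of_ord p0.2) (nat_of_ord (s p0.1)).
  by move: (nat_of_ord (s p0.2)) (nat_of_ord l) (pos l) (pos a); lia.
rewrite addn0; move: c d la.
move: (nat_of_ord p.1) (nat_of_ord p.2) (nat_of_ord l) (nat_of_ord (s p.1)).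
by move: (nat_of_ord (s p.2)) (pos l) (pos a); lia.
Qed.

Lemma pos_count a : \sum_(b < n) (pos b < pos a : nat) = pos a.
Proof.
transitivity (\sum_(i < n) (i < pos a : nat)).
  by rewrite [RHS](reindex_inj (@perm_inj _ (s^-1)%g)).
rewrite -[RHS]card_ord -sum1_card (big_ord_widen n (fun=> 1) (ltnW (ltn_ord _))).
by rewrite [RHS]big_mkcond; apply: eq_bigr => i _ /=; case: ltnP.
Qed.

End Injectivity.

(** By induction on the level, the block numbers agree for two words with the
same image; hence so do the relative positions of any two letters. *)
Lemma PhiSZ_inj n : injective (@PhiSZ n).
Proof.
move=> s s' e.
have eF : descent_tops s = descent_tops s'.
  by apply/setP => j; rewrite -!PhiSZ_lower e.
have eF' : descent_bottoms s = descent_bottoms s'.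
  by apply/setP => j; rewrite -[j](permKV (PhiSZ s)) PhiSZ_bottom e PhiSZ_bottom eF.
have e31 j : vinc31_2_at s j = vinc31_2_at s' j by rewrite !PhiSZ_cros e.
have eB (h : nat) : h <= n -> forall a : 'I_n, a < h ->
    block_index s h a = block_index s' h a.
  elim: h => // h IH hn a; pose l := Ordinal hn.
  rewrite ltnS leq_eqVlt => /orP[/eqP ah|ah].
    rewrite (_ : a = l); last exact: val_inj.
    by rewrite (block_index_new s l) (block_index_new s' l) e31 eF'.
  have := block_index_step s (ah : a < l); have := block_index_step s' (ah : a < l).
  rewrite -!block_index_pos // e31 eF eF' /= !(IH (ltnW hn)) // => <-.
  by move/addIn.
have elt (l a : 'I_n) : a < l ->
    ((s^-1)%g l < (s^-1)%g a) = ((s'^-1)%g l < (s'^-1)%g a).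
  by move=> al; rewrite -!block_index_pos // e31 eB // ltnW.
apply/(can_inj invgK)/permP => a; apply/val_inj.
rewrite /= -[LHS]pos_count -[RHS]pos_count; apply: eq_bigr => b _; congr nat_of_bool.
have [ab|ba|/val_inj->] := ltngtP a b; last by rewrite !ltnn.
  exact: elt.
have := elt _ _ ba; have := pos_neq s ba; have := pos_neq s' ba.
move: (nat_of_ord ((s^-1)%g a)) (nat_of_ord ((s^-1)%g b)).
by move: (nat_of_ord ((s'^-1)%g a)) (nat_of_ord ((s'^-1)%g b)); lia.
Qed.

(** * The involution exchanges 2-13 and 2-31 *)

Lemma PhiSZ_phi_hat n (s : 'S_n) : PhiSZ (phi_hat s) = theta_hat (PhiSZ s).
Proof. by rewrite f_finv //; apply: PhiSZ_inj. Qed.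

Lemma phi_hatK n : involutive (@phi_hat n.+1).
Proof.
by move=> s; apply: (@PhiSZ_inj n.+1); rewrite !PhiSZ_phi_hat theta_hatK.
Qed.

Lemma vinc31_2_phi_hat n (s : 'S_n.+1) l :
  vinc31_2_at (phi_hat s) (rev_ord l) = vinc31_2_at s l.
Proof. by rewrite !PhiSZ_cros PhiSZ_phi_hat cros_theta. Qed.

Lemma vinc2_31_phi_hat n (s : 'S_n.+1) l :
  vinc2_31_at (phi_hat s) (rev_ord l) = vinc2_13_at s l.
Proof.
apply: (@addIn ((l \notin descent_tops s) && (s ord_max < l))).
rewrite up_down_crossings !PhiSZ_nest PhiSZ_phi_hat -!PhiSZ_lower.
exact: (nest_theta _ (PhiSZ_last s)).
Qed.

Theorem mainTheorem2 (n : nat) (n_gt0 : 0 < n) :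
  involutive (@phi_hat n) /\
  (forall s : 'S_n,
     (vinc31_2 s, vinc2_13 s, vinc2_31 s) =
     (vinc31_2 (phi_hat s), vinc2_31 (phi_hat s), vinc2_13 (phi_hat s))) /\
  (forall (R : comNzRingType) (q r s : R),
     P_gf n 1%R q r s = P_gf n 1%R q s r).
Proof.
case: n n_gt0 => // n _; split; first exact: phi_hatK.
have sum31 (s : 'S_n.+1) : vinc31_2 (phi_hat s) = vinc31_2 s.
  rewrite /vinc31_2 (reindex_inj rev_ord_inj).
  by apply: eq_bigr => l _; apply: vinc31_2_phi_hat.
have sum13 (s : 'S_n.+1) : vinc2_31 (phi_hat s) = vinc2_13 s.
  rewrite /vinc2_31 (reindex_inj rev_ord_inj).
  by apply: eq_bigr => l _; apply: vinc2_31_phi_hat.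
have sum13' (s : 'S_n.+1) : vinc2_13 (phi_hat s) = vinc2_31 s.
  by rewrite -sum13 phi_hatK.
split=> [s|R q r s]; first by rewrite sum31 sum13 sum13'.
rewrite /P_gf (reindex_inj (inv_inj (@phi_hatK n))); apply: eq_bigr => t _.
by rewrite !GRing.expr1n sum31 sum13 sum13' -!GRing.mulrA
   [(r ^+ _ * _)%R]GRing.mulrC.
Qed.
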